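(* The logic $\mathrm{BD}_\infty$ (respectively $\mathrm{LP}_\infty$, $\mathrm{K}_\infty$, $\mathrm{CL}_\infty$) is complete as a finitary logic with respect to the family of structures $\boldsymbol{\mathcal{DM}}_n$ (respectively $\boldsymbol{\mathcal{P}}_n$, $\boldsymbol{\mathcal{K}}_n$, $\boldsymbol{\mathcal{B}}_n$), $n\ge1$; and $\mathrm{KO}_\infty$ is complete as a finitary logic with respect to the family of structures $\boldsymbol{\mathcal{P}}_i\otimes\boldsymbol{\mathcal{K}}_j$ ($i,j\ge0$, $i+j\ge1$). That is, a finitary rule (finite set of premises) is valid in the logic if and only if it is valid in every structure of the corresponding family.
   Context: Formulas are built from variables using $\wedge,\vee,\neg$. A structure is a pair $\langle\mathbf{A},F\rangle$, $F\subseteq A$; a rule $\Gamma\vdash\varphi$ is valid in it if every homomorphism $v$ from the formula algebra with $v[\Gamma]\subseteq F$ has $v(\varphi)\in F$. A logic is a substitution-invariant consequence relation; the extension of a logic by rules is the smallest logic containing it and those rules. $\mathrm{BD}_\infty$ is the logic determined by all structures $\langle\mathbf{A},F\rangle$ with $\mathbf{A}$ a De~Morgan lattice (distributive lattice with $\neg$ satisfying $\neg\neg x=x$ and De~Morgan laws) and $F$ an upset. $\mathrm{LP}_\infty$: extension of $\mathrm{BD}_\infty$ by $\emptyset\vdash x\vee\neg x$ and $x\vdash x\wedge(y\vee\neg y)$; $\mathrm{K}_\infty$: by $(x\wedge\neg x)\vee y\vdash y$; $\mathrm{CL}_\infty$: by all three; $\mathrm{KO}_\infty$: by $((x\wedge\neg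 x)\wedge z)\vee u\vdash((y\vee\neg y)\wedge z)\vee u$. $\mathbf{DM}_1$: four-element De~Morgan lattice on $\{\mathsf f,\mathsf n,\mathsf b,\mathsf t\}$, $\mathsf f<\mathsf n,\mathsf b<\mathsf t$, $\mathsf n,\mathsf b$ incomparable, $\neg\mathsf t=\mathsf f$, $\neg\mathsf n=\mathsf n$, $\neg\mathsf b=\mathsf b$. $\boldsymbol{\mathcal{DM}}_1=\langle\mathbf{DM}_1,\{\mathsf t,\mathsf b\}\rangle$; $\boldsymbol{\mathcal{P}}_1,\boldsymbol{\mathcal{K}}_1,\boldsymbol{\mathcal{B}}_1$ are its substructures on $\{\mathsf t,\mathsf b,\mathsf f\}$, $\{\mathsf t,\mathsf n,\mathsf f\}$, $\{\mathsf t,\mathsf f\}$ with designated sets $\{\mathsf t,\mathsf b\},\{\mathsf t\},\{\mathsf t\}$. Dual product: $\langle\prod\mathbf{A}_k,\bigcup_k\pi_k^{-1}[F_k]\rangle$; $\boldsymbol{\mathcal{DM}}_n$ etc. are $n$-fold dual powers, and $\boldsymbol{\mathcal{P}}_i\otimes\boldsymbol{\mathcal{K}}_j$ is the dual product of $i$ copies of $\boldsymbol{\mathcal{P}}_1$ and $j$ copies of $\boldsymbol{\mathcal{K}}_1$. *)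

(* Defs.v *)
From mathcomp Require Import all_boot.
From mathcomp Require Import boolp classical_sets cardinality.

Set Implicit Arguments.
Unset Strict Implicit.
Unset Printing Implicit Defensive.

Local Open Scope classical_set_scope.

Record algebra : Type := Algebra {
  carrier :> Type;
  meet : carrier -> carrier -> carrier;
  join : carrier -> carrier -> carrier;
  neg : carrier -> carrier
}.

Record is_hom (A B : algebra) (h : A -> B) : Prop := IsHom {
  hom_meet : forall x y, h (meet x y) = meet (h x) (h y);
  hom_join : forall x y, h (join x y) = join (h x) (h y);
  hom_neg : forall x, h (neg x) = neg (h x)
}.

Inductive formula : Type :=
| Var of nat
| And of formula & formula
| Or of formula & formula
| Neg of formula.

Definition formula_algebra : algebra := Algebra And Or Neg.

Definition leA (A : algebra) (x y : A) : Prop := meet x y = x.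

Record is_DeMorgan_lattice (A : algebra) : Prop := IsDeMorganLattice {
  dm_meetC : forall x y : A, meet x y = meet y x;
  dm_joinC : forall x y : A, join x y = join y x;
  dm_meetA : forall x y z : A, meet x (meet y z) = meet (meet x y) z;
  dm_joinA : forall x y z : A, join x (join y z) = join (join x y) z;
  dm_meetK : forall x y : A, meet x (join x y) = x;
  dm_joinK : forall x y : A, join x (meet x y) = x;
  dm_distr : forall x y z : A, meet x (join y z) = join (meet x y) (meet x z);
  dm_negK : forall x : A, neg (neg x) = x;
  dm_neg_meet : forall x y : A, neg (meet x y) = join (neg x) (neg y);
  dm_neg_join : forall x y : A, neg (join x y) = meet (neg x) (neg y)
}.

Definition is_upset (A : algebra) (F : set A) : Prop :=
  forall x y : A, leA x y -> F x -> F y.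

Record structure : Type := Structure {
  alg :> algebra;
  designated : set alg
}.

Definition valid (S : structure) (G : set formula) (phi : formula) : Prop :=
  forall v : formula_algebra -> S, is_hom v ->
    v @` G `<=` designated (s := S) -> designated (v phi).

Definition consequence : Type := set formula -> formula -> Prop.

Record is_logic (L : consequence) : Prop := IsLogic {
  logic_refl : forall (G : set formula) phi, G phi -> L G phi;
  logic_mono : forall (G D : set formula) phi, G `<=` D -> L G phi -> L D phi;
  logic_cut : forall (G D : set formula) phi,
    (forall psi, D psi -> L G psi) -> L (G `|` D) phi -> L G phi;
  logic_subst : forall (s : formula_algebra -> formula_algebra) (G : set formula) phi,
    is_hom s -> L G phi -> L (s @` G) (s phi)
}.

Definition rule : Type := (set formula * formula)%type.

Definition determined_by (K : structure -> Prop) : consequence :=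
  fun G phi => forall S, K S -> valid S G phi.

(* The smallest logic containing [L] and [R], as an intersection. *)
Definition extension (L : consequence) (R : set rule) : consequence :=
  fun G phi => forall L' : consequence, is_logic L' ->
    (forall D psi, L D psi -> L' D psi) ->
    (forall r, R r -> L' r.1 r.2) -> L' G phi.

Lemma extension_is_logic L R : is_logic (extension L R).
Proof.
split.
- by move=> G phi Gphi L' HL' _ _; apply: logic_refl.
- move=> G D phi sGD HG L' HL' LL' RL'.
  by apply: (logic_mono HL' sGD); apply: HG.
- move=> G D phi HD Hphi L' HL' LL' RL'.
  apply: (logic_cut HL' (D := D)); last exact: Hphi.
  by move=> psi Dpsi; apply: HD.
- move=> s G phi hs HG L' HL' LL' RL'.
  by apply: (logic_subst HL' hs); apply: HG.
Qed.

Definition finitarily_complete (L : consequence) (K : structure -> Prop) : Prop :=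
  forall (G : set formula) phi, finite_set G ->
    (L G phi <-> determined_by K G phi).

(* The empty upset is allowed, so [BD_inf] has no theorems. *)
Definition BD_inf : consequence :=
  determined_by (fun S : structure =>
    is_DeMorgan_lattice S /\ is_upset (designated (s := S))).

Local Notation vx := (Var 0).
Local Notation vy := (Var 1).
Local Notation vz := (Var 2).
Local Notation vu := (Var 3).

Definition excluded_middle : rule := (set0, Or vx (Neg vx)).
Definition add_tautology : rule := ([set vx], And vx (Or vy (Neg vy))).
Definition drop_contradiction : rule := ([set Or (And vx (Neg vx)) vy], vy).
Definition kleene_order : rule :=
  ([set Or (And (And vx (Neg vx)) vz) vu], Or (And (Or vy (Neg vy)) vz) vu).

Definition LP_inf : consequence :=
  extension BD_inf [set excluded_middle; add_tautology].
Definition K_inf : consequence :=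
  extension BD_inf [set drop_contradiction].
Definition CL_inf : consequence :=
  extension BD_inf [set excluded_middle; add_tautology; drop_contradiction].
Definition KO_inf : consequence :=
  extension BD_inf [set kleene_order].

Inductive four : Type := Vf | Vn | Vb | Vt.

Definition four_meet (x y : four) : four :=
  match x, y with
  | Vt, a | a, Vt => a
  | Vn, Vn => Vn
  | Vb, Vb => Vb
  | _, _ => Vf
  end.

Definition four_join (x y : four) : four :=
  match x, y with
  | Vf, a | a, Vf => a
  | Vn, Vn => Vn
  | Vb, Vb => Vb
  | _, _ => Vt
  end.

Definition four_neg (x : four) : four :=
  match x with Vf => Vt | Vn => Vn | Vb => Vb | Vt => Vf end.

Definition DM1_algebra : algebra := Algebra four_meet four_join four_neg.

Lemma DM1_is_DeMorgan_lattice : is_DeMorgan_lattice DM1_algebra.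
Proof. by split; repeat case. Qed.

Definition DM1 : structure :=
  @Structure DM1_algebra [set Vt; Vb].

Record closed_under (A : algebra) (U : A -> bool) : Prop := ClosedUnder {
  closed_meet : forall x y, U x -> U y -> U (meet x y);
  closed_join : forall x y, U x -> U y -> U (join x y);
  closed_neg : forall x, U x -> U (neg x)
}.

Definition subalgebra (A : algebra) (U : A -> bool) (c : closed_under U) :
    algebra :=
  @Algebra {x : A | U x}
    (fun x y => exist (fun a => U a) _ (closed_meet c (proj2_sig x) (proj2_sig y)))
    (fun x y => exist (fun a => U a) _ (closed_join c (proj2_sig x) (proj2_sig y)))
    (fun x => exist (fun a => U a) _ (closed_neg c (proj2_sig x))).

Definition substructure (S : structure) (U : S -> bool) (c : closed_under U) :
    structure :=
  @Structure (subalgebra c) [set x | designated (proj1_sig x)].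

Definition P1_carrier (x : DM1) : bool := if x is Vn then false else true.
Definition K1_carrier (x : DM1) : bool := if x is Vb then false else true.
Definition B1_carrier (x : DM1) : bool :=
  match x with Vt | Vf => true | _ => false end.

Lemma P1_closed : closed_under P1_carrier.
Proof. by split=> [[] []|[] []|[]]. Qed.

Lemma K1_closed : closed_under K1_carrier.
Proof. by split=> [[] []|[] []|[]]. Qed.

Lemma B1_closed : closed_under B1_carrier.
Proof. by split=> [[] []|[] []|[]]. Qed.

Definition P1 : structure := substructure P1_closed.
Definition K1 : structure := substructure K1_closed.
Definition B1 : structure := substructure B1_closed.

Definition product_algebra (I : Type) (A : I -> algebra) : algebra :=
  @Algebra (forall k, A k)
    (fun x y k => meet (x k) (y k))
    (fun x y k => join (x k) (y k))
    (fun x k => neg (x k)).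

Definition dual_product (I : Type) (S : I -> structure) : structure :=
  @Structure (product_algebra S)
    (\bigcup_(k in [set: I]) [set x | designated (x k)]).

Definition dual_power (S : structure) (n : nat) : structure :=
  dual_product (fun _ : 'I_n => S).

Definition dual_powers (S T : structure) (i j : nat) : structure :=
  dual_product (fun k : 'I_i + 'I_j => if k is inl _ then S else T).

Definition DM_family (S : structure) : Prop :=
  exists n, (1 <= n)%N /\ S = dual_power DM1 n.
Definition P_family (S : structure) : Prop :=
  exists n, (1 <= n)%N /\ S = dual_power P1 n.
Definition K_family (S : structure) : Prop :=
  exists n, (1 <= n)%N /\ S = dual_power K1 n.
Definition B_family (S : structure) : Prop :=
  exists n, (1 <= n)%N /\ S = dual_power B1 n.
Definition PK_family (S : structure) : Prop :=
  exists i j, (1 <= i + j)%N /\ S = dual_powers P1 K1 i j.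

(* Main.v *)
Require Import Defs.
From mathcomp Require Import all_boot.
From mathcomp Require Import boolp classical_sets cardinality.

(** If each premise [g] of a finite nonempty set [G] has a valuation in some
    component [S] designating [g] but not [phi], then these valuations, taken
    together as one valuation into the dual product, designate all of [G] but
    not [phi].  Hence validity in a family of dual products reduces to
    [g |- phi] for a single premise [g].  For [DM1] this means [g <= phi] in
    all De Morgan lattices, by the prime filter theorem.  For the other
    structures let [tau] be the meet of all [x \/ ~x] and [kappa] the join of
    all [x /\ ~x], over the variables [x] of [g] and [phi]: then [g |- phi]
    holds in [P1], [K1], [B1] only if, respectively, [g /\ tau |- phi],
    [g |- kappa \/ phi], [g /\ tau |- kappa \/ phi] hold in [DM1], and the
    rules of each logic introduce [tau] and eliminate [kappa].  For [KO_inf],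
    [g] yields [(kappa /\ g) \/ phi], which the rule turns into
    [(tau /\ g) \/ phi], hence into [phi]. *)

Set Implicit Arguments.
Unset Strict Implicit.
Unset Printing Implicit Defensive.

Local Open Scope classical_set_scope.

(** * Evaluation of formulas under assignments of the variables *)

Fixpoint eval (A : algebra) (w : nat -> A) (a : formula) : A :=
  match a with
  | Var i => w i
  | And b c => meet (eval w b) (eval w c)
  | Or b c => join (eval w b) (eval w c)
  | Neg b => neg (eval w b)
  end.

Lemma eval_hom (A : algebra) (w : nat -> A) :
  @is_hom formula_algebra A (eval w).
Proof. by split. Qed.

Lemma hom_evalE (A : algebra) (v : formula_algebra -> A) (a : formula) :
  is_hom v -> v a = eval (fun i => v (Var i)) a.
Proof.
by case=> vM vJ vN; elim: a => [//|b IHb c IHc|b IHb c IHc|b IHb] /=;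
  rewrite -?IHb -?IHc ?(vM b c) ?(vJ b c) ?(vN b).
Qed.

Fixpoint maxvar (a : formula) : nat :=
  match a with
  | Var i => i
  | And b c | Or b c => maxn (maxvar b) (maxvar c)
  | Neg b => maxvar b
  end.

Lemma eq_eval (A : algebra) (w w' : nat -> A) (n : nat) (a : formula) :
  (forall i, i <= n -> w i = w' i) -> maxvar a <= n -> eval w a = eval w' a.
Proof.
move=> eqw; elim: a => [i|b IHb c IHc|b IHb c IHc|b IHb] /=; first exact: eqw.
- by rewrite geq_max => /andP[/IHb-> /IHc->].
- by rewrite geq_max => /andP[/IHb-> /IHc->].
- by move=> /IHb->.
Qed.

(** * Prime filters and entailment in the four-element lattice *)

Section PrimeFilter.

Variables (A : algebra) (dmA : is_DeMorgan_lattice A).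

Local Notation "x <=A y" := (leA x y) (at level 70).

Lemma leA_refl (x : A) : x <=A x.
Proof. by rewrite /leA -{2}(dm_joinK dmA x x) (dm_meetK dmA). Qed.

Lemma leA_trans (y x z : A) : x <=A y -> y <=A z -> x <=A z.
Proof. by rewrite /leA => xy yz; rewrite -xy -(dm_meetA dmA) yz. Qed.

Lemma leA_meetl (x y : A) : meet x y <=A x.
Proof.
by rewrite /leA (dm_meetC dmA) (dm_meetA dmA); congr meet; exact: leA_refl.
Qed.

Lemma leA_meetr (x y : A) : meet x y <=A y.
Proof. by rewrite (dm_meetC dmA); exact: leA_meetl. Qed.

Lemma leA_meetI (z x y : A) : z <=A x -> z <=A y -> z <=A meet x y.
Proof. by rewrite /leA => zx zy; rewrite (dm_meetA dmA) zx. Qed.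

Lemma leA_joinl (x y : A) : x <=A join x y.
Proof. exact: (dm_meetK dmA). Qed.

Lemma leA_joinr (x y : A) : y <=A join x y.
Proof. by rewrite (dm_joinC dmA); exact: leA_joinl. Qed.

Lemma leA_joinU (x y z : A) : x <=A z -> y <=A z -> join x y <=A z.
Proof.
rewrite /leA => xz yz.
by rewrite (dm_meetC dmA) (dm_distr dmA) ![meet z _](dm_meetC dmA) xz yz.
Qed.

Lemma leA_meet2 (x y x' y' : A) :
  x <=A x' -> y <=A y' -> meet x y <=A meet x' y'.
Proof.
move=> xx' yy'; apply: leA_meetI.
- exact: leA_trans (leA_meetl _ _) xx'.
- exact: leA_trans (leA_meetr _ _) yy'.
Qed.

Record prime_filter (P : set A) : Prop := PrimeFilter {
  prime_up : is_upset P;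
  prime_meet : forall x y, P x -> P y -> P (meet x y);
  prime_join : forall x y, P (join x y) -> P x \/ P y
}.

(** A filter maximal among those that contain [a] and omit [b] is prime: if it omits [x] and [y],
    adding either one forces [b], and by distributivity so does [join x y]. *)
Lemma prime_filter_separation (a b : A) :
  ~ (a <=A b) -> exists P, [/\ prime_filter P, P a & ~ P b].
Proof.
move=> nab.
(* The last clause lets [set0] in, as Zorn_bigcup requires. *)
pose Q := [set X : set A | [/\ is_upset X,
  forall x y, X x -> X y -> X (meet x y), ~ X b & forall x, X x -> X a]].
have [|P [[upP mP nPb Pa] maxP]] := @Zorn_bigcup _ Q.
  move=> F FQ totF; split.
  - move=> x y xy [X FX Xx]; exists X => //.
    by have [up _ _ _] := FQ _ FX; exact: up xy Xx.
  - move=> x y [X FX Xx] [Y FY Yy].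
    have [XY|YX] := totF _ _ FX FY.
    + by exists Y => //; have [_ m _ _] := FQ _ FY; apply: m => //; exact: XY.
    + by exists X => //; have [_ m _ _] := FQ _ FX; apply: m => //; exact: YX.
  - by case=> X FX Xb; have [_ _ + _] := FQ _ FX.
  - by move=> x [X FX Xx]; exists X => //; have [_ _ _ /(_ _ Xx)] := FQ _ FX.
have QP X : Q X -> P `<=` X -> X `<=` P.
  by move=> QX PX; apply: contrapT => nXP; exact: maxP QX.
(* If [a] were missing, [P] would be empty, and the principal filter of [a] would contradict
   maximality. *)
have {}Pa : P a.
  apply: contrapT => nPa; apply: (nPa); apply: (QP (leA a)); last exact: leA_refl.
    split=> //; last by move=> *; exact: leA_refl.
    - by move=> x y xy ax; exact: leA_trans xy.
    - exact: leA_meetI.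
  by move=> x /Pa.
(* The filter generated by [P] and [x] is strictly larger than [P], so by maximality it contains
   [b]. *)
have ext x : ~ P x -> exists2 p, P p & meet p x <=A b.
  move=> nPx; apply: contrapT => nb; apply: nPx.
  apply: (QP [set z | exists2 p, P p & meet p x <=A z]); last first.
  - by exists a => //; exact: leA_meetr.
  - by move=> z Pz; exists z => //; exact: leA_meetl.
  split=> //.
  - by move=> y z yz [p Pp px]; exists p => //; exact: leA_trans yz.
  - move=> y z [p Pp px] [q Pq qx]; exists (meet p q); first exact: mP.
    apply: leA_meetI.
    + by apply: leA_trans px; apply: leA_meet2 (leA_refl _); exact: leA_meetl.
    + by apply: leA_trans qx; apply: leA_meet2 (leA_refl _); exact: leA_meetr.
  - by move=> y _; exists a => //; exact: leA_meetl.
exists P; split=> //; split=> // x y Pxy.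
apply: contrapT => /not_orP[/ext[p Pp px] /ext[q Pq qy]].
apply: nPb; apply: upP (mP _ _ (mP _ _ Pp Pq) Pxy).
rewrite (dm_distr dmA); apply: leA_joinU.
- by apply: leA_trans px; apply: leA_meet2 (leA_refl _); exact: leA_meetl.
- by apply: leA_trans qy; apply: leA_meet2 (leA_refl _); exact: leA_meetr.
Qed.

(** The values [Vt] and [Vb] are taken exactly on [P], so [P] is the preimage of the designated set
    of [DM1]. *)
Definition four_of (P : set A) (x : A) : four :=
  match `[< P x >], `[< P (neg x) >] with
  | true, true => Vb
  | true, false => Vt
  | false, true => Vf
  | false, false => Vn
  end.

Lemma four_of_hom (P : set A) :
  prime_filter P -> @is_hom A DM1_algebra (four_of P).
Proof.
case=> up mP jP.
have PM x y : `[< P (meet x y) >] = `[< P x >] && `[< P y >].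
  apply/asboolP/andP => [Pxy|[/asboolP Px /asboolP Py]]; last exact: mP.
  split; apply/asboolP; first exact: up (leA_meetl _ _) Pxy.
  exact: up (leA_meetr _ _) Pxy.
have PJ x y : `[< P (join x y) >] = `[< P x >] || `[< P y >].
  apply/asboolP/orP => [/jP[] ?|[] /asboolP Px].
  - by left; apply/asboolP.
  - by right; apply/asboolP.
  - exact: up (leA_joinl _ _) Px.
  - exact: up (leA_joinr _ _) Px.
split=> [x y|x y|x]; rewrite /four_of.
- rewrite (dm_neg_meet dmA) PM PJ.
  by do 4 case: `[< _ >].
- rewrite (dm_neg_join dmA) PM PJ.
  by do 4 case: `[< _ >].
- rewrite (dm_negK dmA).
  by do 2 case: `[< _ >].
Qed.

End PrimeFilter.

Definition des (x : four) : bool :=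
  match x with Vt | Vb => true | _ => false end.

Lemma desP (x : four) : designated (s := DM1) x <-> des x.
Proof. by case: x; split=> //=; (try by case); [right|left]. Qed.

(** Restricting the assignments to [U] expresses validity in a substructure without subset types. *)
Definition entails_on (U : four -> bool) (a b : formula) : Prop :=
  forall w : nat -> DM1_algebra,
    (forall i, U (w i)) -> des (eval w a) -> des (eval w b).

Local Notation entails := (entails_on xpredT).

(** If [v a] is not below [v b], a prime filter separating them carries the failure to [DM1];
    otherwise the upset passes from [v a] to [v b]. *)
Lemma entails_BD (a b : formula) : entails a b -> BD_inf [set a] b.
Proof.
move=> ab S [dmS upS] v hv va.
apply: upS (va _ (ex_intro2 _ _ a erefl erefl)).
apply: contrapT => /(prime_filter_separation dmS)[P [prP Pa nPb]].
have hP := four_of_hom dmS prP.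
have hPv : @is_hom formula_algebra DM1_algebra (four_of P \o v).
  split=> [x y|x y|x] /=.
  - by rewrite (hom_meet hv) (hom_meet hP).
  - by rewrite (hom_join hv) (hom_join hP).
  - by rewrite (hom_neg hv) (hom_neg hP).
have desE c : des (four_of P (v c)) = `[< P (v c) >].
  by rewrite /four_of; do 2 case: `[< _ >].
apply/nPb/asboolP; rewrite -desE.
rewrite -[four_of _ _]/((four_of P \o v) b) (hom_evalE b hPv).
by apply: ab => //; rewrite -(hom_evalE a hPv) /= desE; apply/asboolP.
Qed.

Lemma valid_DM1_entails (a b : formula) : valid DM1 [set a] b -> entails a b.
Proof.
move=> ab w _ /desP wa; apply/desP; apply: (ab _ (eval_hom w)).
by move=> _ [_ -> <-].
Qed.

Lemma eval_substructure (U : DM1 -> bool) (c : closed_under U)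
    (w : nat -> DM1) (Uw : forall i, U (w i)) (a : formula) :
  proj1_sig (eval (A := substructure c) (fun i => exist _ (w i) (Uw i)) a) =
  eval w a.
Proof. by elim: a => [//|b IHb d IHd|b IHb d IHd|b IHb] /=; rewrite ?IHb ?IHd. Qed.

Lemma valid_substructureP (U : DM1 -> bool) (c : closed_under U)
    (a b : formula) :
  valid (substructure c) [set a] b <-> entails_on U a b.
Proof.
split=> [ab w Uw /desP wa|ab v hv va].
  apply/desP; rewrite -(eval_substructure c Uw).
  apply: (ab _ (eval_hom _)) => _ [_ -> <-].
  by rewrite /= eval_substructure.
have vE d : proj1_sig (v d) = eval (fun i => proj1_sig (v (Var i))) d.
  elim: d => [//|d IHd e IHe|d IHd e IHe|d IHd] /=.
  - by rewrite (hom_meet hv d e) /= IHd IHe.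
  - by rewrite (hom_join hv d e) /= IHd IHe.
  - by rewrite (hom_neg hv d) /= IHd.
apply/desP; rewrite vE; apply: ab => [i|]; first exact: (proj2_sig (v (Var i))).
by rewrite -vE; apply/desP; apply: va; exists a.
Qed.

Lemma valid_mono (S : structure) (G D : set formula) (a : formula) :
  G `<=` D -> valid S G a -> valid S D a.
Proof.
move=> GD Ga v hv vD; apply: Ga => // _ [g Gg <-].
by apply: vD; exists g => //; exact: GD.
Qed.

(** Since [Vn] is an undesignated fixed point of all operations, [DM1] and [K1] have no theorems. *)
Lemma eval_const_n (a : formula) : eval (A := DM1_algebra) (fun=> Vn) a = Vn.
Proof. by elim: a => [//|b IHb c IHc|b IHb c IHc|b IHb] /=; rewrite IHb ?IHc. Qed.

Lemma not_valid_DM1_set0 (a : formula) : ~ valid DM1 set0 a.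
Proof.
move=> va; have := va _ (eval_hom (A := DM1) (fun=> Vn)).
rewrite image_set0 => /(_ (@sub0set _ _)) /desP.
by rewrite eval_const_n.
Qed.

Lemma not_valid_K1_set0 (a : formula) : ~ valid K1 set0 a.
Proof.
move=> va.
have := va _ (eval_hom (A := K1) (fun=> exist _ (Vn : DM1) (erefl : K1_carrier Vn))).
rewrite image_set0 => /(_ (@sub0set _ _)) /desP.
by rewrite eval_substructure eval_const_n.
Qed.

(** * Dual products *)

Section DualProduct.

Variables (I : Type) (S : I -> structure).

(** One designated coordinate designates the whole element, so each premise may use its own
    coordinate, while [phi] must fail in all of them. *)
Lemma dual_product_refute (v : forall k, formula_algebra -> S k)
    (G : set formula) (phi : formula) :
  (forall k, is_hom (v k)) -> (forall k, ~ designated (v k phi)) ->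
  (forall g, G g -> exists k, designated (v k g)) ->
  ~ valid (dual_product S) G phi.
Proof.
move=> hv nphi vG /(_ (fun a k => v k a)); case.
- split=> [x y|x y|x]; apply: functional_extensionality_dep => k /=.
  + exact: (hom_meet (hv k)).
  + exact: (hom_join (hv k)).
  + exact: (hom_neg (hv k)).
- by move=> _ [g /vG[k vkg] <-]; exists k.
- by move=> k _; exact: nphi.
Qed.

Lemma proj_hom (v : formula_algebra -> dual_product S) (k : I) :
  is_hom v -> is_hom (A := formula_algebra) (B := S k) (fun a => v a k).
Proof.
by case=> vM vJ vN; split=> [x y|x y|x]; rewrite ?(vM x y) ?(vJ x y) ?(vN x).
Qed.

(** The conclusion is designated at the coordinate where the premise is; two premises might need
    different coordinates. *)
Lemma valid1_dual_product (a b : formula) :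
  (forall k, valid (S k) [set a] b) -> valid (dual_product S) [set a] b.
Proof.
move=> Sab v hv va.
have [k _ vka] : designated (v a) by apply: va; exists a.
exists k => //; apply: (Sab k _ (proj_hom k hv)) => _ [_ -> <-].
exact: vka.
Qed.

Lemma valid0_dual_product (k : I) (a : formula) :
  valid (S k) set0 a -> valid (dual_product S) set0 a.
Proof.
move=> Sa v hv _; exists k => //; apply: (Sa _ (proj_hom k hv)).
by rewrite image_set0; exact: sub0set.
Qed.

End DualProduct.

Definition upset_DM (S : structure) : Prop :=
  is_DeMorgan_lattice S /\ is_upset (designated (s := S)).

Lemma upset_DM_dual_product (I : Type) (S : I -> structure) :
  (forall k, upset_DM (S k)) -> upset_DM (dual_product S).
Proof.
move=> dmS; split; last first.
  move=> x y /(congr1 (fun f => f _)) xy [k _ xk]; exists k => //.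
  by have [_ up] := dmS k; exact: up (xy k) xk.
split=> [x y|x y|x y z|x y z|x y|x y|x y z|x|x y|x y];
  apply: functional_extensionality_dep => k /=; have [dm _] := dmS k.
- exact: dm_meetC.
- exact: dm_joinC.
- exact: dm_meetA.
- exact: dm_joinA.
- exact: dm_meetK.
- exact: dm_joinK.
- exact: dm_distr.
- exact: dm_negK.
- exact: dm_neg_meet.
- exact: dm_neg_join.
Qed.

Lemma upset_DM_DM1 : upset_DM DM1.
Proof.
split; first exact: DM1_is_DeMorgan_lattice.
by move=> x y xy /desP dx; apply/desP; case: x y xy dx => -[].
Qed.

Lemma upset_DM_substructure (U : DM1 -> bool) (c : closed_under U) :
  upset_DM (substructure c).
Proof.
have [_ up] := upset_DM_DM1; split; last first.
  by move=> x y /(congr1 (@proj1_sig _ _)) xy; exact: up xy.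
have dm := DM1_is_DeMorgan_lattice.
split=> *; apply: val_inj.
- exact: (dm_meetC dm).
- exact: (dm_joinC dm).
- exact: (dm_meetA dm).
- exact: (dm_joinA dm).
- exact: (dm_meetK dm).
- exact: (dm_joinK dm).
- exact: (dm_distr dm).
- exact: (dm_negK dm).
- exact: (dm_neg_meet dm).
- exact: (dm_neg_join dm).
Qed.

(** * Soundness *)

Lemma determined_by_is_logic (K : structure -> Prop) : is_logic (determined_by K).
Proof.
split=> [G phi Gphi S _ v _ vG|G D phi GD Gphi S KS|G D phi GD Dphi S KS v hv vG|
  s G phi hs Gphi S KS v hv vsG].
- by apply: vG; exists phi.
- exact: valid_mono GD (Gphi S KS).
- apply: (Dphi S KS v hv) => _ [g [Gg|Dg] <-]; first by apply: vG; exists g.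
  exact: GD Dg S KS v hv vG.
- apply: (Gphi S KS (v \o s)) => [|_ [g Gg <-]]; last first.
    by apply: vsG; exists (s g) => //; exists g.
  split=> [x y|x y|x] /=.
  + by rewrite (hom_meet hs) (hom_meet hv).
  + by rewrite (hom_join hs) (hom_join hv).
  + by rewrite (hom_neg hs) (hom_neg hv).
Qed.

(** The consequence [determined_by K] is itself one of the logics intersected in [extension]. *)
Lemma extension_sound (R : set rule) (K : structure -> Prop)
    (G : set formula) (phi : formula) :
  (forall S, K S -> upset_DM S) ->
  (forall S, K S -> forall r, R r -> valid S r.1 r.2) ->
  extension BD_inf R G phi -> determined_by K G phi.
Proof.
move=> KDM KR /(_ _ (determined_by_is_logic K)); apply.
- by move=> D psi Dpsi S /KDM; exact: Dpsi.
- by move=> r Rr S /KR; exact.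
Qed.

Lemma add_tautology_P1 : valid P1 add_tautology.1 add_tautology.2.
Proof.
apply/valid_substructureP => w Uw /=.
by case: (w 0) => //; case: (w 1) (Uw 1).
Qed.

Lemma excluded_middle_P1 : valid P1 excluded_middle.1 excluded_middle.2.
Proof.
move=> v hv _; apply/desP.
by rewrite (hom_join hv (Var 0) (Neg (Var 0))) (hom_neg hv (Var 0)) /=;
  case: (v (Var 0)) => -[].
Qed.

Lemma drop_contradiction_K1 : valid K1 drop_contradiction.1 drop_contradiction.2.
Proof.
apply/valid_substructureP => w Uw /=.
by case: (w 0) (Uw 0) => // _; case: (w 1) (Uw 1).
Qed.

Lemma B1_carrierE (x : DM1) : B1_carrier x = P1_carrier x && K1_carrier x.
Proof. by case: x. Qed.

Lemma add_tautology_B1 : valid B1 add_tautology.1 add_tautology.2.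
Proof.
apply/valid_substructureP => w Uw; apply: (valid_substructureP P1_closed _ _).1.
- exact: add_tautology_P1.
- by move=> i; have := Uw i; rewrite B1_carrierE => /andP[].
Qed.

Lemma drop_contradiction_B1 : valid B1 drop_contradiction.1 drop_contradiction.2.
Proof.
apply/valid_substructureP => w Uw; apply: (valid_substructureP K1_closed _ _).1.
- exact: drop_contradiction_K1.
- by move=> i; have := Uw i; rewrite B1_carrierE => /andP[].
Qed.

Lemma excluded_middle_B1 : valid B1 excluded_middle.1 excluded_middle.2.
Proof.
move=> v hv _; apply/desP.
by rewrite (hom_join hv (Var 0) (Neg (Var 0))) (hom_neg hv (Var 0)) /=;
  case: (v (Var 0)) => -[].
Qed.

(** In [P1] the formula [y \/ ~y] is always designated. *)
Lemma kleene_order_P1 : valid P1 kleene_order.1 kleene_order.2.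
Proof.
apply/valid_substructureP => w Uw /=.
by case: (w 1) (Uw 1) => // _; case: (w 0); case: (w 2); case: (w 3).
Qed.

(** In [K1] the formula [x /\ ~x] is never designated, so [u] must be. *)
Lemma kleene_order_K1 : valid K1 kleene_order.1 kleene_order.2.
Proof.
apply/valid_substructureP => w Uw /=.
by case: (w 0) (Uw 0) => // _; case: (w 1) (Uw 1) => // _;
  case: (w 2) (Uw 2) => // _; case: (w 3) (Uw 3).
Qed.

(** * Reduction to a single premise *)

Lemma not_validP (S : structure) (G : set formula) (phi : formula) :
  ~ valid S G phi -> exists v : formula_algebra -> S,
    [/\ is_hom v, forall g, G g -> designated (v g) & ~ designated (v phi)].
Proof.
move=> nv; apply: contrapT => nex; apply: nv => v hv vG.
apply: contrapT => nphi; apply: nex; exists v; split=> // g Gg.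
by apply: vG; exists g.
Qed.

(** Ordinals index the dual powers, so an enumeration gives each premise its own factor. *)
Lemma finite_set_ord (T : Type) (G : set T) :
  finite_set G -> exists n (f : 'I_n -> T), G = range f.
Proof.
case=> n /card_esym/card_bijP[f [g _ fK]].
exists n, (fun k : 'I_n => proj1_sig (f (exist _ (val k) (mem_set (ltn_ord k))))).
apply/seteqP; split=> [x Gx|_ [k _ <-]]; last first.
  by case: (f _) => x /= /set_mem.
pose y : G := exist _ x (mem_set Gx).
have lt : proj1_sig (g y) < n by exact: set_mem (proj2_sig (g y)).
exists (Ordinal lt) => //=.
rewrite (_ : exist _ _ _ = g y) ?fK //.
exact: val_inj.
Qed.

Lemma dual_power_single_premise (S : structure) (G : set formula)
    (phi : formula) :
  finite_set G -> (forall n, (1 <= n)%N -> valid (dual_power S n) G phi) ->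
  valid S set0 phi \/ exists2 g, G g & valid S [set g] phi.
Proof.
move=> /finite_set_ord[n [f ->]] vG; apply: contrapT.
move=> /not_orP[/not_validP[v0 [hv0 _ nv0]] nG].
have {}nG k : exists v : formula_algebra -> S,
    [/\ is_hom v, designated (v (f k)) & ~ designated (v phi)].
  have [v [hv vk nv]] : exists v : formula_algebra -> S,
      [/\ is_hom v, forall g, [set f k] g -> designated (v g)
        & ~ designated (v phi)].
    by apply: not_validP => vk; apply: nG; exists (f k) => //; exists k.
  by exists v; split=> //; exact: vk.
have [v vP] := choice nG.
case: n f vG nG v vP => [|n] f vG nG v vP.
  (* Without premises the product would have no factor, so [v0] is placed in the first power. *)
  apply: (dual_product_refute (v := fun _ : 'I_1 => v0)) (vG 1%N isT) => //.
  by move=> g [[]].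
apply: (dual_product_refute (v := v)) (vG n.+1 isT) => [k|k|_ [k _ <-]].
- by case: (vP k).
- by case: (vP k).
- by exists k; case: (vP k).
Qed.

Lemma dual_powers_single_premise (S T : structure) (G : set formula)
    (phi : formula) :
  finite_set G ->
  (forall i j, (1 <= i + j)%N -> valid (dual_powers S T i j) G phi) ->
  valid T set0 phi \/ exists g, [/\ G g, valid S [set g] phi & valid T [set g] phi].
Proof.
move=> /finite_set_ord[n [f ->]] vG; apply: contrapT.
move=> /not_orP[/not_validP[v0 [hv0 _ nv0]] nG].
(* If no premise works for both structures, those in [D] are refuted in a factor [S] and the others
   in a factor [T]. *)
pose D := [pred k : 'I_n | ~~ `[< valid S [set f k] phi >]].
have vS (x : 'I_#|D|) : exists v : formula_algebra -> S,
    [/\ is_hom v, designated (v (f (enum_val x))) & ~ designated (v phi)].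
  have /asboolPn/not_validP[v [hv vk nv]] := enum_valP x.
  by exists v; split=> //; exact: vk.
have vT (x : 'I_#|[predC D]|) : exists v : formula_algebra -> T,
    [/\ is_hom v, designated (v (f (enum_val x))) & ~ designated (v phi)].
  have := enum_valP x; rewrite !inE negbK => /asboolP vSk.
  have [vTk|/not_validP[v [hv vk nv]]] := pselect (valid T [set f (enum_val x)] phi).
    by case: nG; exists (f (enum_val x)); split=> //; exists (enum_val x).
  by exists v; split=> //; exact: vk.
have [u uP] := choice vS; have [v vP] := choice vT.
have [n0|n_gt0] := posnP n.
  (* Without premises, a single copy of [T] carries [v0]; the left branch is vacuous. *)
  pose w (k : 'I_0 + 'I_1) : formula_algebra -> if k is inl _ then S else T :=
    match k with inl a => fun=> False_rect _ (notF (ltn_ord a)) | inr _ => v0 end.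
  apply: (dual_product_refute (v := w)) (vG 0%N 1%N isT) => [[[]|]//|[[]|]//|].
  by move=> g [k _ _]; move: (ltn_ord k); rewrite {2}n0.
pose w (k : 'I_#|D| + 'I_#|[predC D]|) :
    formula_algebra -> if k is inl _ then S else T :=
  match k with inl a => u a | inr b => v b end.
have ij : (1 <= #|D| + #|[predC D]|)%N by rewrite cardC card_ord.
apply: (dual_product_refute (v := w)) (vG _ _ ij) => [[] k /=|[] k /=|_ [k _ <-]].
- by case: (uP k).
- by case: (vP k).
- by case: (uP k).
- by case: (vP k).
- have [Dk|nDk] := boolP (k \in D).
    exists (inl (enum_rank_in Dk k)) => /=.
    by have [_ + _] := uP (enum_rank_in Dk k); rewrite enum_rankK_in.
  have {}nDk : k \in [predC D] by rewrite inE.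
  exists (inr (enum_rank_in nDk k)) => /=.
  by have [_ + _] := vP (enum_rank_in nDk k); rewrite enum_rankK_in.
Qed.

(** * Normal forms and derivations *)

Definition lem (a : formula) : formula := Or a (Neg a).
Definition con (a : formula) : formula := And a (Neg a).

(** There are no constants to serve as empty meet or join, so [tau] and [kappa] start at variable 0
    and cover the variables up to and including [n]. *)
Fixpoint tau (n : nat) : formula :=
  if n is m.+1 then And (lem (Var n)) (tau m) else lem (Var 0).

Fixpoint kappa (n : nat) : formula :=
  if n is m.+1 then Or (con (Var n)) (kappa m) else con (Var 0).

Lemma des_meet (x y : four) : des (four_meet x y) = des x && des y.
Proof. by case: x; case: y. Qed.

Lemma des_join (x y : four) : des (four_join x y) = des x || des y.
Proof. by case: x; case: y. Qed.

(** In [DM1], [lem x] is undesignated only when [x] takes the value [Vn]. *)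
Lemma des_tau (w : nat -> DM1_algebra) (n i : nat) :
  des (eval w (tau n)) -> i <= n -> P1_carrier (w i).
Proof.
elim: n => [|n IHn] /=; first by rewrite leqn0 => + /eqP->; case: (w 0).
rewrite des_meet => /andP[wn /IHn wi].
by rewrite leq_eqVlt => /predU1P[->|//]; move: wn; case: (w n.+1).
Qed.

(** In [DM1], [con x] is designated only when [x] takes the value [Vb]. *)
Lemma des_kappa (w : nat -> DM1_algebra) (n i : nat) :
  ~~ des (eval w (kappa n)) -> i <= n -> K1_carrier (w i).
Proof.
elim: n => [|n IHn] /=; first by rewrite leqn0 => + /eqP->; case: (w 0).
rewrite des_join negb_or => /andP[wn /IHn wi].
by rewrite leq_eqVlt => /predU1P[->|//]; move: wn; case: (w n.+1).
Qed.

Lemma entails_on_bounded (U : four -> bool) (n : nat) (a b : formula)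
    (w : nat -> DM1_algebra) :
  U Vt -> entails_on U a b -> maxvar a <= n -> maxvar b <= n ->
  (forall i, i <= n -> U (w i)) -> des (eval w a) -> des (eval w b).
Proof.
move=> Ut ab an bn Uw.
(* Variables beyond [n] may take values outside [U]; they are reset to [Vt], which affects neither
   formula. *)
pose w' i : DM1_algebra := if i <= n then w i else Vt.
have ww' i : i <= n -> w i = w' i by rewrite /w' => ->.
rewrite (eq_eval ww' an) (eq_eval ww' bn); apply: ab => i.
by rewrite /w'; case: ifP => // /Uw.
Qed.

Lemma entails_P1_tau (n : nat) (a b : formula) :
  entails_on P1_carrier a b -> maxvar a <= n -> maxvar b <= n ->
  entails (And a (tau n)) b.
Proof.
move=> ab an bn w _ /=; rewrite des_meet => /andP[wa wt].
by apply: (entails_on_bounded _ ab an bn) wa => // i; exact: des_tau.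
Qed.

Lemma entails_K1_kappa (n : nat) (a b : formula) :
  entails_on K1_carrier a b -> maxvar a <= n -> maxvar b <= n ->
  entails a (Or (kappa n) b).
Proof.
move=> ab an bn w _ wa /=; rewrite des_join; case: (boolP (des _)) => //= wk.
by apply: (entails_on_bounded _ ab an bn) wa => // i; exact: des_kappa.
Qed.

Lemma entails_B1_tau_kappa (n : nat) (a b : formula) :
  entails_on B1_carrier a b -> maxvar a <= n -> maxvar b <= n ->
  entails (And a (tau n)) (Or (kappa n) b).
Proof.
move=> ab an bn w _ /=; rewrite des_meet des_join => /andP[wa wt].
case: (boolP (des _)) => //= wk.
apply: (entails_on_bounded _ ab an bn) wa => // i iN.
by rewrite (B1_carrierE (w i)) (des_tau wt) ?(des_kappa wk).
Qed.

(** * Derivations in an arbitrary logic containing [BD_inf] *)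

Section Derivations.

Variables (L : consequence) (logicL : is_logic L).
Hypothesis BD_L : forall D psi, BD_inf D psi -> L D psi.

Lemma derive1 (G : set formula) (a b : formula) : L [set a] b -> L G a -> L G b.
Proof.
move=> ab Ga; apply: (logic_cut logicL (D := [set a])); first by move=> _ ->.
by apply: logic_mono ab => // x; right.
Qed.

(** Rearrangements inside derivations thereby reduce to Boolean checks on [des]. *)
Lemma derive_entails (G : set formula) (a b : formula) :
  entails a b -> L G a -> L G b.
Proof. by move=> /entails_BD/BD_L; exact: derive1. Qed.

Lemma instance (w : nat -> formula) (D : set formula) (a : formula) :
  L D a -> L (eval (A := formula_algebra) w @` D) (eval (A := formula_algebra) w a).
Proof. by apply: (logic_subst logicL); exact: eval_hom. Qed.

Lemma derive_tau (n : nat) (G : set formula) (a : formula) :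
  L add_tautology.1 add_tautology.2 -> L G a -> L G (And a (tau n)).
Proof.
move=> r; have step (b c : formula) : L G b -> L G (And b (lem c)).
  have := instance (fun i => if i is 0 then b else c) r.
  by rewrite image_set1; exact: derive1.
move=> Ga; elim: n => [|n IHn]; first exact: step.
apply: derive_entails (step _ (Var n.+1) IHn) => w _ /=.
by rewrite !des_meet; case/andP=> /andP[-> ->] ->.
Qed.

Lemma derive_theorem_tau (n : nat) (G : set formula) :
  L excluded_middle.1 excluded_middle.2 ->
  L add_tautology.1 add_tautology.2 -> L G (tau n).
Proof.
move=> em r; apply: (derive_entails (a := And (lem (Var 0)) (tau n))).
  by move=> w _ /=; rewrite des_meet => /andP[].
by apply: derive_tau => //; apply: logic_mono em => // x [].
Qed.

Lemma derive_drop_kappa (n : nat) (G : set formula) (a : formula) :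
  L drop_contradiction.1 drop_contradiction.2 ->
  L G (Or (kappa n) a) -> L G a.
Proof.
move=> r; have step (b c : formula) : L G (Or (con c) b) -> L G b.
  have := instance (fun i => if i is 0 then c else b) r.
  by rewrite image_set1; exact: derive1.
elim: n => [|n IHn]; first exact: step.
move=> Ga; apply: IHn; apply: (step _ (Var n.+1)).
by apply: derive_entails Ga => w _ /=; rewrite !des_join orbA.
Qed.

Section KleeneOrder.

Hypothesis ko : L kleene_order.1 kleene_order.2.

(* For [n > 0] the premise is applied to [con x /\ z] in place of [z], so that
   [con x] is still there for the last variable. *)
Lemma derive_con_tau (n : nat) (G : set formula) (x z u : formula) :
  L G (Or (And (con x) z) u) -> L G (Or (And (tau n) z) u).
Proof.
have step (y z' : formula) :
    L G (Or (And (con x) z') u) -> L G (Or (And (lem y) z') u).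
  (* The default value [u] of [nth] is what variable 3 of the rule is mapped to. *)
  have := instance (fun i => nth u [:: x; y; z'] i) ko.
  by rewrite image_set1; exact: derive1.
elim: n z => [|n IHn] z; first exact: step.
move=> Gxz; have : L G (Or (And (tau n) (And (con x) z)) u).
  apply: IHn; apply: derive_entails Gxz => w _.
  by rewrite /= !(des_join, des_meet); do 4 case: (des _).
move=> Gtxz; have : L G (Or (And (lem (Var n.+1)) (And (tau n) z)) u).
  apply: step; apply: derive_entails Gtxz => w _.
  by rewrite /= !(des_join, des_meet); do 5 case: (des _).
by apply: derive_entails => w _; rewrite /= !(des_join, des_meet) !andbA.
Qed.

(** One disjunct [con] of [kappa] is converted at a time, with the remaining ones stored in the side
    formula; hence the induction keeps [u] general. The copies of [And (tau n) z] are merged at the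
    end. *)
Lemma derive_kappa_tau (m n : nat) (G : set formula) (z u : formula) :
  L G (Or (And (kappa m) z) u) -> L G (Or (And (tau n) z) u).
Proof.
elim: m u => [|m IHm] u; first exact: derive_con_tau.
move=> Gk; have : L G (Or (And (con (Var m.+1)) z) (Or (And (kappa m) z) u)).
  apply: derive_entails Gk => w _.
  by rewrite /= !(des_join, des_meet); do 5 case: (des _).
move=> /(derive_con_tau n) Gt.
have : L G (Or (And (kappa m) z) (Or (And (tau n) z) u)).
  apply: derive_entails Gt => w _.
  by rewrite /= !(des_join, des_meet); do 4 case: (des _).
move=> /IHm; apply: derive_entails => w _.
by rewrite /= !(des_join, des_meet); do 3 case: (des _).
Qed.

End KleeneOrder.

End Derivations.

(** * Soundness and completeness of the five logics *)

Theorem mainTheorem9 :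
  [/\ finitarily_complete BD_inf DM_family,
      finitarily_complete LP_inf P_family,
      finitarily_complete K_inf K_family,
      finitarily_complete CL_inf B_family
    & finitarily_complete KO_inf PK_family].
Proof.
have leN a b : maxvar a <= maxn (maxvar a) (maxvar b) by exact: leq_maxl.
have leM a b : maxvar b <= maxn (maxvar a) (maxvar b) by exact: leq_maxr.
split=> G phi finG; split.
- move=> Gphi S [n [_ ->]]; apply: Gphi.
  by apply: upset_DM_dual_product => _; exact: upset_DM_DM1.
- move=> vG; have [|/not_valid_DM1_set0//|[g Gg gphi]] :=
      dual_power_single_premise (S := DM1) (phi := phi) finG.
    by move=> n n0; apply: vG; exists n.
  have : BD_inf [set g] phi by apply/entails_BD/valid_DM1_entails.
  by apply: (logic_mono (determined_by_is_logic _)) => _ ->.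
- apply: extension_sound => S [n [n0 ->]].
    by apply: upset_DM_dual_product => _; exact: upset_DM_substructure.
  move=> _ [->|->].
  (* A theorem needs a coordinate to be designated at; [n0] provides coordinate 0. *)
  + exact: (@valid0_dual_product _ (fun=> P1) (Ordinal n0) _ excluded_middle_P1).
  + by apply: valid1_dual_product => _; exact: add_tautology_P1.
- move=> vG L logicL BDL RL.
  have em : L excluded_middle.1 excluded_middle.2 by apply: RL; left.
  have at_ : L add_tautology.1 add_tautology.2 by apply: RL; right.
  have [g Gg gphi] : exists2 g, L G g & entails_on P1_carrier g phi.
    have [|v0|[g Gg gphi]] :=
        dual_power_single_premise (S := P1) (phi := phi) finG.
    + by move=> n n0; apply: vG; exists n.
    (* When [phi] is a theorem of [P1], the derivable formula [tau 0] stands in for a premise. *)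
    + exists (tau 0); first exact: derive_theorem_tau.
      apply/(valid_substructureP P1_closed); exact: valid_mono (@sub0set _ _) v0.
    + exists g; first exact: logic_refl.
      exact/(valid_substructureP P1_closed).
  apply: derive_entails (derive_tau logicL BDL _ at_ Gg) => //.
  exact: entails_P1_tau gphi (leN _ _) (leM _ _).
- apply: extension_sound => S [n [n0 ->]].
    by apply: upset_DM_dual_product => _; exact: upset_DM_substructure.
  by move=> _ ->; apply: valid1_dual_product => _; exact: drop_contradiction_K1.
- move=> vG L logicL BDL RL.
  have dc : L drop_contradiction.1 drop_contradiction.2 by apply: RL.
  have [|/not_valid_K1_set0//|[g Gg gphi]] :=
      dual_power_single_premise (S := K1) (phi := phi) finG.
    by move=> n n0; apply: vG; exists n.
  apply: (derive_drop_kappa logicL BDL dc).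
  apply: (derive_entails logicL BDL) (logic_refl logicL Gg).
  apply: entails_K1_kappa (leN _ _) (leM _ _).
  exact/(valid_substructureP K1_closed).
- apply: extension_sound => S [n [n0 ->]].
    by apply: upset_DM_dual_product => _; exact: upset_DM_substructure.
  move=> _ [[->|->]|->].
  + exact: (@valid0_dual_product _ (fun=> B1) (Ordinal n0) _ excluded_middle_B1).
  + by apply: valid1_dual_product => _; exact: add_tautology_B1.
  + by apply: valid1_dual_product => _; exact: drop_contradiction_B1.
- move=> vG L logicL BDL RL.
  have em : L excluded_middle.1 excluded_middle.2 by apply: RL; left; left.
  have at_ : L add_tautology.1 add_tautology.2 by apply: RL; left; right.
  have dc : L drop_contradiction.1 drop_contradiction.2 by apply: RL; right.
  have [g Gg gphi] : exists2 g, L G g & entails_on B1_carrier g phi.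
    have [|v0|[g Gg gphi]] :=
        dual_power_single_premise (S := B1) (phi := phi) finG.
    + by move=> n n0; apply: vG; exists n.
    + exists (tau 0); first exact: derive_theorem_tau.
      apply/(valid_substructureP B1_closed); exact: valid_mono (@sub0set _ _) v0.
    + exists g; first exact: logic_refl.
      exact/(valid_substructureP B1_closed).
  apply: (derive_drop_kappa logicL BDL dc).
  apply: derive_entails (derive_tau logicL BDL _ at_ Gg) => //.
  exact: entails_B1_tau_kappa gphi (leN _ _) (leM _ _).
- apply: extension_sound => S [i [j [ij ->]]].
    by apply: upset_DM_dual_product => -[] _; exact: upset_DM_substructure.
  move=> _ ->; apply: valid1_dual_product => -[] _.
  + exact: kleene_order_P1.
  + exact: kleene_order_K1.
- move=> vG L logicL BDL RL.
  have ko : L kleene_order.1 kleene_order.2 by apply: RL.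
  have [|/not_valid_K1_set0//|[g [Gg gP gK]]] :=
      dual_powers_single_premise (S := P1) (T := K1) (phi := phi) finG.
    by move=> i j ij; apply: vG; exists i, j.
  have {}gP := entails_P1_tau ((valid_substructureP P1_closed _ _).1 gP)
    (leN _ _) (leM _ _).
  have {}gK := entails_K1_kappa ((valid_substructureP K1_closed _ _).1 gK)
    (leN _ _) (leM _ _).
  set n := maxn _ _ in gP gK.
  (* Working backwards: by [gP] the first disjunct already entails [phi]. *)
  apply: (@derive_entails _ logicL BDL _ (Or (And (tau n) g) phi)).
    move=> w _ /=; rewrite des_join des_meet => /orP[/andP[wt wg]|//].
    by apply: gP => //=; rewrite des_meet wg.
  (* It remains to reach the same formula with [kappa n] for [tau n], which follows from [g] by
     [gK]. *)
  apply: (derive_kappa_tau logicL BDL ko (m := n)).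
  apply: (derive_entails logicL BDL) (logic_refl logicL Gg) => w _ wg /=.
  rewrite des_join des_meet wg andbT -des_join.
  exact: gK.
Qed.
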